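(* Let $\alpha=2$, let $m\ge 0$ be an integer, let $2>\alpha_1>\dots>\alpha_m>0$ with $2-\alpha_m\le 1$, and let $c>0$, $c_j>0$ for $j=1,\dots,m$. Let $w(x,t)$ be the propagation function associated with these parameters. Then $w(x,t)\equiv 0$ for $x>t/\sqrt{c}$ (where $x,t>0$).
   Context: If $m=0$, the sums over $j$ are empty and the conditions on the $\alpha_j$ and $c_j$ are void. Put $g(s)=c s^{2}+\sum_{j=1}^m c_j s^{\alpha_j}$. Let $D_t^\beta$ denote the Caputo derivative of order $\beta>0$ in time (with $D_t^2=\partial_t^2$), and $H$ the Heaviside unit step function. The propagation function $w(x,t)$ is the solution of $$cD_t^{2}w(x,t)+\sum_{j=1}^m c_j D_t^{\alpha_j}w(x,t)=w_{xx}(x,t),\quad x,t>0,$$ $$w(x,0)=w_t(x,0)=0,\ x>0;\qquad w(0,t)=H(t),\quad w\to 0\ \text{as } x\to\infty,\ t>0,$$ obtained by the Laplace transform in time: for each $x>0$, $w(x,\cdot)$ is the function with $$\int_0^\infty e^{-st}w(x,t)\,\mathrm{d}t=\frac1s\exp\left(-x\sqrt{g(s)}\right),\quad s>0,$$ normalized to be continuous in $t$ wherever possible (i.e. away from a possible jump at $t=\sqrt{c}\,x$). *)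

(* Defs.v *)
From HB Require Import structures.
From mathcomp Require Import all_boot all_order all_algebra.
From mathcomp Require Import all_classical all_reals all_analysis.

Set Implicit Arguments.
Unset Strict Implicit.
Unset Printing Implicit Defensive.

Import Order.TTheory GRing.Theory Num.Theory.
Import numFieldNormedType.Exports.

Local Open Scope classical_set_scope.
Local Open Scope ring_scope.

(* The symbol of c D_t^2 + \sum_j c_j D_t^(alpha_j). *)
Definition symbol (R : realType) (m : nat) (alpha : 'I_m -> R)
    (c : R) (cj : 'I_m -> R) (s : R) : R :=
  c * s ^+ 2 + \sum_(j < m) cj j * s `^ alpha j.

(* Absolute (Lebesgue) convergence at s is part of the definition, since the
   library's integral takes junk values on non-integrable functions. *)
Definition has_laplace_at (R : realType) (f : R -> R) (s l : R) : Prop :=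
  (@lebesgue_measure R).-integrable `]0%R, +oo[
    (fun t => (expR (- (s * t)) * f t)%:E) /\
  (\int[@lebesgue_measure R]_(t in `]0%R, +oo[)
    (expR (- (s * t)) * f t)%:E = l%:E)%E.

(* The solution of
     c D_t^2 w + \sum_j c_j D_t^(alpha_j) w = w_xx,  x, t > 0,
     w(x,0) = w_t(x,0) = 0,  w(0,t) = H(t),  w -> 0 as x -> oo,
   is in general not classically differentiable (if m = 0, w jumps along
   t = sqrt c * x); it is the function given by its Laplace transform in t.
   The transform fixes w(x,.) only up to a null set. The last two clauses select
   the representative that is continuous wherever possible: everywhere except
   perhaps at t = sqrt c * x, and there too unless the
   discontinuity is not removable. Values of w outside x, t > 0 are irrelevant. *)
Definition propagation_function (R : realType) (m : nat) (alpha : 'I_m -> R)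
    (c : R) (cj : 'I_m -> R) (w : R -> R -> R) : Prop :=
  forall x : R, 0 < x ->
  [/\ forall s : R, 0 < s ->
        has_laplace_at (w x) s
          (s^-1 * expR (- (x * Num.sqrt (symbol alpha c cj s)))),
      forall t : R, 0 < t -> t != Num.sqrt c * x -> {for t, continuous (w x)} &
      forall t : R, 0 < t -> cvg (w x u @[u --> t^']) ->
        {for t, continuous (w x)}].

(* Main.v *)
Require Import Defs.
From HB Require Import structures.
From mathcomp Require Import all_boot all_order all_algebra.
From mathcomp Require Import all_classical all_reals all_analysis.
From mathcomp Require Import measurable_realfun ring lra.

Set Implicit Arguments.
Unset Strict Implicit.
Unset Printing Implicit Defensive.

Import Order.TTheory GRing.Theory Num.Theory.
Import numFieldNormedType.Exports.

Local Open Scope classical_set_scope.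
Local Open Scope ring_scope.

(** The theorem is finite propagation speed read off from a Laplace transform.
Since every c_j is positive, the symbol satisfies g(s) >= c s^2, so that the
transform of f = w(x,.) is at most exp (- s T) for s >= 1, with T = sqrt c * x.
A function whose transform is O(exp (- s T)) along the real axis vanishes at
its points of continuity in ]0, T[: this is laplace_decay_eq0, and the rest of the
argument concerns it.

The argument stays on the real axis, by the inversion formula of Phragmen and
Doetsch. Put Phi(y) = 1 - exp (- y). As lam -> +oo, the function
u |-> Phi(exp (lam (t - u))) tends to the indicator of ]-oo, t[ off the point t
and, because Phi(y) <= min(1, y), it stays below exp (t - u) for lam >= 1.
Since exp (- u) f(u) is integrable, dominated convergence shows that the integral
of f over ]0, t] is the limit of the integrals of Phi(exp (lam (t - u))) f(u).
On the other hand the Taylor series of Phi has no constant term; substituting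
exp (lam (t - u)) and integrating term by term expresses those integrals through
the transform L at the points k lam, k >= 1:

  sum_(k >= 1) (-1)^(k-1) / k! * exp (k lam t) * L(k lam).

If L(s) = O(exp (- s T)), this is O(y exp y) with y = exp (lam (t - T)), hence it
tends to 0 when t < T (laplace_smooth_step_le). So the integral of f over ]0, t]
vanishes for every t < T (laplace_decay_integral_eq0), and at a point of
continuity of f the fundamental theorem of calculus gives f t = 0. *)

(** * A smooth step and its Taylor polynomials *)

Definition smooth_step (R : realType) (y : R) : R := 1 - expR (- y).

(** The Taylor polynomial of degree K at 0 of smooth_step, written from its
degree one term on: the constant term is zero, so that in the integrals below
the transform is only evaluated at positive points. *)
Definition smooth_step_poly (R : realType) (K : nat) (y : R) : R :=
  - \sum_(k < K) (- y) ^+ k.+1 / k.+1`!%:R.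

(** Termwise, y ^ (k+1) / (k+1)! <= y * (y ^ k / k!). The factor y matters: it is
what makes the bound small for small y, and it supplies a decaying exponential
when y = exp (lam (t - u)). *)
Lemma sum_exp_tail_le (R : realType) (K : nat) (y : R) : 0 <= y ->
  \sum_(k < K) y ^+ k.+1 / k.+1`!%:R <= y * expR y.
Proof.
move=> y0.
have sum_le : series (exp_coeff y) K <= expR y.
  apply: (nondecreasing_cvgn_le _ (is_cvg_series_exp_coeff y)).
  apply: nondecreasing_series => k _ _.
  by rewrite /exp_coeff /= divr_ge0 ?exprn_ge0.
apply: le_trans (ler_wpM2l y0 sum_le).
rewrite seriesEord mulr_sumr; apply: ler_sum => k _.
rewrite /exp_coeff /= exprS -mulrA ler_wpM2l// ler_wpM2l ?exprn_ge0//.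
by rewrite lef_pV2 ?posrE ?ltr0n ?fact_gt0// ler_nat factS leq_pmull.
Qed.

Lemma smooth_step_poly_cvg (R : realType) (y : R) :
  smooth_step_poly K y @[K --> \oo] --> smooth_step y.
Proof.
have -> : (fun K => smooth_step_poly K y) = (fun K => 1 - series (exp_coeff (- y)) K.+1).
  apply/funext => K; rewrite /smooth_step_poly /series /= big_mkord.
  rewrite big_ord_recl /exp_coeff /=.
  by rewrite expr0 fact0 invr1 mulr1 opprD addrA subrr add0r.
apply: cvgB; first exact: cvg_cst.
by rewrite cvg_shiftS; exact: is_cvg_series_exp_coeff.
Qed.

Lemma normr_smooth_step_poly_le (R : realType) (K : nat) (y : R) : 0 <= y ->
  `|smooth_step_poly K y| <= y * expR y.
Proof.
move=> y0; rewrite normrN; apply: le_trans (sum_exp_tail_le K y0).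
apply: le_trans (ler_norm_sum _ _ _) _; apply: ler_sum => k _.
by rewrite normrM normrX normrN (ger0_norm y0) normfV normr_nat.
Qed.

(** The bound 1 serves on the left of the step, the bound y on its right. *)
Lemma normr_smooth_step_le (R : realType) (y : R) : 0 <= y ->
  `|smooth_step y| <= Num.min 1 y.
Proof.
move=> y0; have e1 : expR (- y) <= 1 by rewrite expR_le1 oppr_le0.
rewrite /smooth_step ger0_norm ?subr_ge0// le_min lerBlDr lerDl expR_ge0 /=.
by have := expR_ge1Dx (- y); lra.
Qed.

Lemma smooth_step_cvg1 (R : realType) (a : R) : 0 < a ->
  smooth_step (expR (n.+1%:R * a)) @[n --> \oo] --> (1 : R).
Proof.
move=> a0; rewrite -[X in _ --> X]subr0; apply: cvgB; first exact: cvg_cst.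
apply: (@squeeze_cvgr _ _ _ _ (fun=> 0) (fun n => a^-1 * harmonic n)).
- near=> n; rewrite expR_ge0 /= /harmonic -invfM expRN.
  have p : 0 < a * n.+1%:R by rewrite mulr_gt0.
  rewrite lef_pV2 ?posrE ?expR_gt0//.
  have := expR_ge1Dx (expR (n.+1%:R * a)); have := expR_ge1Dx (n.+1%:R * a).
  by rewrite (mulrC a); lra.
- exact: cvg_cst.
- by rewrite -[X in _ --> X](mulr0 a^-1); apply: cvgMr; exact: cvg_harmonic.
Unshelve. all: by end_near. Qed.

Lemma expR_natM_cvg0 (R : realType) (a : R) : a < 0 ->
  expR (n.+1%:R * a) @[n --> \oo] --> (0 : R).
Proof.
move=> a0; apply: (@squeeze_cvgr _ _ _ _ (fun=> 0) (fun n => (- a)^-1 * harmonic n)).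
- near=> n; rewrite expR_ge0 /= /harmonic -invfM -[n.+1%:R * a]opprK expRN.
  have p : 0 < - a * n.+1%:R by rewrite mulr_gt0 ?oppr_gt0.
  rewrite lef_pV2 ?posrE ?expR_gt0//.
  have := expR_ge1Dx (- (n.+1%:R * a)).
  by rewrite mulNr mulrC; lra.
- exact: cvg_cst.
- by rewrite -[X in _ --> X](mulr0 (- a)^-1); apply: cvgMr; exact: cvg_harmonic.
Unshelve. all: by end_near. Qed.

Lemma smooth_step_cvg0 (R : realType) (a : R) : a < 0 ->
  smooth_step (expR (n.+1%:R * a)) @[n --> \oo] --> (0 : R).
Proof.
move=> a0; apply: norm_cvg0.
apply: (@squeeze_cvgr _ _ _ _ (fun=> 0) (fun n => expR (n.+1%:R * a))).
- near=> n; rewrite normr_ge0 /=; apply: le_trans (normr_smooth_step_le (expR_ge0 _)) _.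
  by rewrite ge_min lexx orbT.
- exact: cvg_cst.
- exact: expR_natM_cvg0.
Unshelve. all: by end_near. Qed.

(** * Real inversion of the Laplace transform *)

Section Laplace_inversion.
Variables (R : realType) (f L : R -> R).
Hypothesis fL : forall s, 0 < s -> has_laplace_at f s (L s).
Local Notation mu := (@lebesgue_measure R).
Local Notation D := (`]0%R, +oo[%classic : set R).

Lemma measurable_has_laplace : measurable_fun D f.
Proof.
have [/measurable_int mf _] := fL ltr01.
move/measurable_EFinP in mf.
have -> : f = (fun u => expR u * (expR (- (1 * u)) * f u)).
  by apply/funext => u; rewrite mul1r mulrA -expRD subrr expR0 mul1r.
apply: measurable_funM => //.
by apply: measurable_funTS; exact: measurable_expR.
Qed.

Lemma measurable_expR_shift (lam t : R) :
  measurable_fun D (fun u => expR (lam * (t - u))).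
Proof.
apply: measurableT_comp; first exact: measurable_expR.
by apply: measurable_funM => //; apply: measurable_funB.
Qed.

(** The powers of exp (lam (t - u)) are, up to a factor, the kernels of the Laplace
transform at the multiples of lam. *)
Lemma laplace_monomial (t lam : R) (k : nat) : 0 < lam ->
  mu.-integrable D (fun u => (expR (lam * (t - u)) ^+ k.+1 * f u)%:E) /\
  (\int[mu]_(u in D) (expR (lam * (t - u)) ^+ k.+1 * f u)%:E =
   (expR (k.+1%:R * (lam * t)) * L (k.+1%:R * lam))%:E)%E.
Proof.
move=> lam0; have [|fi fE] := @fL (k.+1%:R * lam); first by rewrite mulr_gt0.
have E u : (expR (lam * (t - u)) ^+ k.+1 * f u)%:E =
  ((expR (k.+1%:R * (lam * t)))%:E * (expR (- (k.+1%:R * lam * u)) * f u)%:E)%E.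
  rewrite -EFinM; congr (_%:E).
  by rewrite -expRM_natl [RHS]mulrA -expRD; congr (expR _ * _); ring.
split.
  have /(_ (measurable_itv _)) := integrableZl _ (expR (k.+1%:R * (lam * t))) fi.
  by apply: eq_integrable.
under eq_integral => u _ do rewrite E.
by rewrite integralZl// fE.
Qed.

Lemma laplace_smooth_step_poly (t lam : R) (K : nat) : 0 < lam ->
  mu.-integrable D (fun u => (smooth_step_poly K (expR (lam * (t - u))) * f u)%:E) /\
  (\int[mu]_(u in D) (smooth_step_poly K (expR (lam * (t - u))) * f u)%:E =
   (- \sum_(k < K) (-1) ^+ k.+1 / k.+1`!%:R *
      (expR (k.+1%:R * (lam * t)) * L (k.+1%:R * lam)))%:E)%E.
Proof.
move=> lam0.
pose h (k : 'I_K) u :=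
  ((- ((-1) ^+ k.+1 / k.+1`!%:R))%:E * (expR (lam * (t - u)) ^+ k.+1 * f u)%:E)%E.
have E u : (smooth_step_poly K (expR (lam * (t - u))) * f u)%:E = (\sum_(k < K) h k u)%E.
  rewrite /h; under eq_bigr do rewrite -EFinM.
  rewrite sumEFin /smooth_step_poly -sumrN mulr_suml; congr (_%:E).
  by apply: eq_bigr => k _; rewrite (exprNn (expR _)); ring.
have hi k : mu.-integrable D (h k).
  by apply: integrableZl => //; have [] := laplace_monomial t k lam0.
split.
  have /(_ (measurable_itv _)) :=
    integrable_sum _ (index_enum 'I_K) (P := xpredT) (fun k _ => hi k).
  exact: eq_integrable.
under eq_integral => u _ do rewrite E.
rewrite integral_sum// -sumrN -sumEFin; apply: eq_bigr => k _.
have [i1 i2] := laplace_monomial t k lam0.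
by rewrite /h integralZl// i2 -EFinM mulNr.
Qed.

Variables (C T : R).
Hypothesis L_le : forall s, 1 <= s -> `|L s| <= C * expR (- (s * T)).

(** The bound does not depend on K, which is what survives the limit K -> oo. *)
Lemma laplace_smooth_step_poly_le (t lam : R) (K : nat) : 1 <= lam ->
  (`|\int[mu]_(u in D) (smooth_step_poly K (expR (lam * (t - u))) * f u)%:E| <=
   (C * (expR (lam * (t - T)) * expR (expR (lam * (t - T)))))%:E)%E.
Proof.
move=> lam1; have lam0 : 0 < lam by exact: lt_le_trans lam1.
have C0 : 0 <= C.
  by have := le_trans (normr_ge0 _) (L_le (lexx 1)); rewrite pmulr_lge0 ?expR_gt0.
have [_ ->] := laplace_smooth_step_poly t K lam0.
rewrite abse_EFin lee_fin normrN.
apply: le_trans (ler_wpM2l C0 (sum_exp_tail_le K (expR_ge0 _))).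
apply: le_trans (ler_norm_sum _ _ _) _.
rewrite mulr_sumr; apply: ler_sum => k _.
rewrite !normrM normrX normrN normr1 expr1n mul1r normfV normr_nat.
rewrite ger0_norm ?expR_ge0// [leRHS]mulrA [leRHS]mulrC ler_wpM2l//.
have k1 : 1 <= k.+1%:R * lam by rewrite mulr_ege1// ler1n.
apply: le_trans (ler_wpM2l (expR_ge0 _) (L_le k1)) _.
rewrite mulrCA -expRD -expRM_natl le_eqVlt; apply/orP; left; apply/eqP.
by congr (_ * expR _); ring.
Qed.

(** Term by term integration of the Taylor series: the partial sums are dominated
by y exp y with y = exp (lam (t - u)) <= exp (lam t), and f is integrable
against the first factor y. *)
Lemma laplace_smooth_step_le (t lam : R) : 1 <= lam ->
  (`|\int[mu]_(u in D) (smooth_step (expR (lam * (t - u))) * f u)%:E| <=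
   (C * (expR (lam * (t - T)) * expR (expR (lam * (t - T)))))%:E)%E.
Proof.
move=> lam1; have lam0 : 0 < lam by exact: lt_le_trans lam1.
pose G u := (expR (expR (lam * t)) * (expR (lam * (t - u)) ^+ 1 * `|f u|))%:E.
have Gi : mu.-integrable D G.
  have [i1 _] := laplace_monomial t 0 lam0.
  have /(_ (measurable_itv _)) :=
    integrableZl _ (expR (expR (lam * t))) (integrable_abse i1).
  apply: eq_integrable => // u _.
  by rewrite /G /= normrM ger0_norm// exprn_ge0// expR_ge0.
have mS K : measurable_fun D
    (fun u => (smooth_step_poly K (expR (lam * (t - u))) * f u)%:E).
  by have [/measurable_int] := laplace_smooth_step_poly t K lam0.
have cv u : D u -> (smooth_step_poly K (expR (lam * (t - u))) * f u)%:E @[K --> \oo] -->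
    (smooth_step (expR (lam * (t - u))) * f u)%:E.
  move=> _; apply: cvg_EFin; first exact: nearW.
  by apply: cvgMl; exact: smooth_step_poly_cvg.
have dom K u : D u -> (`|(smooth_step_poly K (expR (lam * (t - u))) * f u)%:E| <= G u)%E.
  rewrite /= in_itv /= andbT => u0.
  rewrite lee_fin normrM mulrA ler_wpM2r// expr1 [leRHS]mulrC.
  apply: le_trans (normr_smooth_step_poly_le _ (expR_ge0 _)) _.
  rewrite ler_wpM2l ?expR_ge0// ler_expR ler_expR (ler_wpM2l (ltW lam0))//.
  by rewrite gerBl ltW.
have Gfin u : D u -> G u \is a fin_num by [].
have /(_ (measurable_itv _)) lim := dominated_cvg (mu := mu) _ mS cv Gfin Gi dom.
apply: cvge_to_le (cvg_abse lim) _.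
by apply: nearW => K; exact: laplace_smooth_step_poly_le.
Qed.

(** As lam runs through the positive integers, the integrals against the smooth step
at t converge to the integral over ]0, t] and, by the previous bound, to 0. *)
Lemma laplace_decay_integral_eq0 (t : R) : t < T ->
  (\int[mu]_(u in `]0%R, t]) (f u)%:E = 0)%E.
Proof.
move=> tT.
pose A := [set u : R | u <= t].
pose g n u := (smooth_step (expR (n.+1%:R * (t - u))) * f u)%:E.
have mf : measurable_fun D (EFin \o f).
  by apply/measurable_EFinP; exact: measurable_has_laplace.
have mg n : measurable_fun D (g n).
  apply/measurable_EFinP; apply: measurable_funM measurable_has_laplace.
  apply: measurable_funB => //; apply: measurableT_comp; first exact: measurable_expR.
  by apply: measurable_funN; exact: measurable_expR_shift.
have mA : measurable A.
  by have := measurable_itv `]-oo, t]; rewrite set_itvE.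
have mfA : measurable_fun D ((EFin \o f) \_ A).
  by apply/(measurable_restrict _ _) => //; apply: measurable_funS mf.
pose G u := (expR t * `|expR (- (1 * u)) * f u|)%:E.
have Gi : mu.-integrable D G.
  have [i1 _] := fL ltr01.
  by have /(_ (measurable_itv _)) := integrableZl _ (expR t) (integrable_abse i1).
have dom n u : D u -> (`|g n u| <= G u)%E.
  move=> _; rewrite lee_fin !normrM (ger0_norm (expR_ge0 _)) mulrA -expRD mul1r.
  rewrite ler_wpM2r//; apply: le_trans (normr_smooth_step_le (expR_ge0 _)) _.
  (* 1 <= exp (t - u) on the left of t; on its right the larger exponential is
     the one with the smaller rate, namely 1. *)
  have [tu|ut] := leP 0 (t - u).
    rewrite ge_min; apply/orP; left.
    by rewrite -[leLHS]expR0 ler_expR.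
  rewrite ge_min; apply/orP; right; rewrite ler_expR.
  by rewrite -[leRHS]mul1r (ler_wnM2r (ltW ut))// ler1n.
have cv u : u != t -> g n u @[n --> \oo] --> ((EFin \o f) \_ A) u.
  move=> ut.
  have -> : ((EFin \o f) \_ A) u = ((if u <= t then 1 else 0) * f u)%:E.
    rewrite patchE /A; case: ifPn => [/[!inE] /= ->|]; first by rewrite mul1r.
    by rewrite notin_setE /= => /negP/negbTE ->; rewrite mul0r.
  apply: cvg_EFin; first exact: nearW.
  apply: cvgMl; case: ifPn => [le|].
    by apply: smooth_step_cvg1; rewrite subr_gt0 lt_neqAle ut le.
  by rewrite -ltNge => tu; apply: smooth_step_cvg0; rewrite subr_lt0.
(* At u = t the smooth step is constantly 1 - 1/e, which is why the convergence
   is claimed almost everywhere only. *)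
have aecv : \forall u \ae mu, D u -> g n u @[n --> \oo] --> ((EFin \o f) \_ A) u.
  exists [set t]; split => //; first exact: lebesgue_measure_set1.
  by move=> u /= /not_implyP [_ ncv]; apply: contrapT => /eqP ut; exact/ncv/cv.
have aedom : \forall u \ae mu, forall n, D u -> (`|g n u| <= G u)%E.
  by apply: aeW => u n; exact: dom.
have [_ _ lim] :=
  dominated_convergence (mu := mu) (measurable_itv _) mg mfA aecv Gi aedom.
have -> : `]0%R, t]%classic = D `&` A.
  by apply/seteqP; split => u; rewrite /A /= !in_itv /= andbT => /andP.
rewrite integral_mkcondr; apply/eqP; rewrite -abse_eq0; apply/eqP.
apply: (cvg_unique _ (cvg_abse lim)) => //.
have tT' : t - T < 0 by rewrite subr_lt0.
have e0 := expR_natM_cvg0 tT'.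
apply: (@squeeze_cvge _ _ _ _ (fun=> 0%E) _ (fun n => (C * (expR (n.+1%:R * (t - T)) *
  expR (expR (n.+1%:R * (t - T)))))%:E)).
- by apply: nearW => n; rewrite abse_ge0 /= laplace_smooth_step_le// ler1n.
- exact: cvg_cst.
- apply: cvg_EFin; first exact: nearW.
  rewrite -[X in _ --> X](mulr0 C); apply: cvgMr.
  rewrite -[X in _ --> X](mul0r (expR 0)); apply: cvgM => //.
  by apply: continuous_cvg => //; exact: continuous_expR.
Qed.

(** The support theorem: a Laplace transform that is O(exp (- s T)) at +oo comes
from a function vanishing before T wherever it is continuous. *)
Lemma laplace_decay_eq0 (t : R) : 0 < t -> t < T -> {for t, continuous f} -> f t = 0.
Proof.
move=> t0 tT ft.
have [u tu uT] : exists2 u, t < u & u < T.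
  by exists ((t + T) / 2); lra.
have fi : mu.-integrable `]0%R, u] (EFin \o f).
  have [i1 _] := fL ltr01.
  have sub : `]0%R, u] `<=` D by apply: subset_itvl.
  have gi : mu.-integrable `]0%R, u]
      (fun v => (expR u)%:E * (expR (- (1 * v)) * f v)%:E)%E.
    by apply: integrableZl => //; exact: integrableS i1.
  apply: le_integrable gi => //.
    apply/measurable_EFinP; apply: measurable_funS measurable_has_laplace => //.
  move=> v; rewrite /= in_itv /= => /andP[v0 vu].
  rewrite lee_fin !normrM mulrA ler_peMl// !ger0_norm ?expR_ge0// mul1r.
  by rewrite -expRD -[leLHS]expR0 ler_expR subr_ge0.
have [_ <-] := continuous_FTC1 tu fi t0 ft.
rewrite derive1E -[RHS](derive_cst (0 : R) t 1); apply: near_eq_derive => //.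
have : \forall y \near t, y < T by exact: lt_nbhsl.
apply: filterS => y yT.
by rewrite /Rintegral laplace_decay_integral_eq0.
Qed.

End Laplace_inversion.

(** * Finite propagation speed *)

Theorem theorem2p4 (R : realType) (m : nat) (alpha : 'I_m -> R)
    (c : R) (cj : 'I_m -> R) (w : R -> R -> R)
    (alpha_bounds : forall j : 'I_m, 0 < alpha j < 2)
    (alpha_decr : forall i j : 'I_m, (i < j)%N -> alpha j < alpha i)
    (alpha_last : forall j : 'I_m, j.+1 = m -> 2 - alpha j <= 1)
    (c_gt0 : 0 < c)
    (cj_gt0 : forall j : 'I_m, 0 < cj j)
    (w_prop : propagation_function alpha c cj w) :
  forall x t : R, 0 < x -> 0 < t -> t / Num.sqrt c < x -> w x t = 0.
Proof.
move=> x t x0 t0 tx; have [wL wcont _] := w_prop x x0.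
have sc0 : 0 < Num.sqrt c by rewrite sqrtr_gt0.
have tT : t < Num.sqrt c * x by rewrite mulrC -ltr_pdivrMr.
apply: (laplace_decay_eq0 wL (C := 1) (T := Num.sqrt c * x)) => //; last first.
  by apply: wcont => //; rewrite lt_eqF.
move=> s s1; have s0 : 0 < s by exact: lt_le_trans s1.
rewrite ger0_norm; last by rewrite mulr_ge0 ?expR_ge0// invr_ge0 ltW.
apply: ler_pM; rewrite ?expR_ge0 ?invr_ge0 ?invf_le1 ?(ltW s0)//.
rewrite ler_expR lerN2 mulrA mulrC (ler_wpM2l (ltW x0))//.
have -> : s * Num.sqrt c = Num.sqrt (c * s ^+ 2).
  by rewrite sqrtrM ?(ltW c_gt0)// sqrtr_sqr gtr0_norm// mulrC.
(* The fractional terms only increase the symbol, hence the decay. *)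
rewrite ler_wsqrtr// /symbol lerDl.
by apply: sumr_ge0 => j _; rewrite mulr_ge0 ?powR_ge0// ltW.
Qed.
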